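(* Consider the Gaussian location model $Y^i=\theta+Z^i$, $i\in[n]$, where $\theta\in\mathbb{R}^{d\times m}$ and the entries of the noise matrices $Z^i\in\mathbb{R}^{d\times m}$ are all independent $\mathcal N(0,\sigma^2)$. Let $\bar Y=\frac1n\sum_{i=1}^nY^i=\theta+\bar Z$ with $\bar Z=\frac1n\sum_{i=1}^nZ^i$. (a) (Case $q=0$.) Suppose $m\ge 4s\ge c_1$ and $d\ge 4s_0\ge c_2$ (for constants $c_1,c_2>0$). Let $\hat\theta_0\in\arg\min_{\vartheta\in\Theta^{m,d}_0(s,s_0)}\|\bar Y-\vartheta\|_F^2$. There are positive constants $C_u,C_1,C_2$ such that for any $\epsilon^2 \geq C_u\frac{\sigma^2}{n}\big( s \log \frac{em}{s}+ss_0\log \frac{ed}{s_0}\big)$, $$\sup_{\theta \in \Theta^{m,d}_0(s, s_0)}\|\hat{\theta}_0-\theta\|_F^2\leq \epsilon^2$$ holds with probability greater than $1-C_1\exp \{-C_2n\epsilon^2\}$. (b) (Case $q\in(0,1]$.) Suppose that for constants $C_3,C_4>0$ and $\delta\in(0,1)$, $\frac{d}{R_q n^{q/2}}\ge C_3 d^{\delta}\ge C_4$. Let $\hat\theta_q\in\arg\min_{\vartheta\in\Theta^{m,d}_q(s,R_q)}\|\bar Y-\vartheta\|_F^2$. There are positive constants $C_u,C_1,C_2$ such that for any $\epsilon^2 \geq C_u\big\{\frac{\sigma^2}{n}s\log\frac{em}{s}+s R_q\big(\frac{\sigma^2 }{n}\log d\big)^{1-\frac{q}{2}}\big\}$, $$\sup_{\theta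 \in \Theta^{m,d}_q(s, R_q)}\|\hat{\theta}_q-\theta\|_F^2\leq \epsilon^2$$ holds with probability greater than $1-C_1\exp \{-C_2n\epsilon^2\}$.
   Context: $[n]=\{1,\dots,n\}$; $n\ge1$, $d\ge2$, $1\le s\le m$, $1\le s_0\le d$ are integers, $R_q>0$, $\sigma>0$. For $\theta=(\theta_1,\dots,\theta_m)\in\mathbb{R}^{d\times m}$ with columns $\theta_j\in\mathbb{R}^d$, $\|\theta\|_F$ is the Frobenius norm and $\|\theta\|_{0,2}=\sum_{j=1}^m\mathbb{I}(\|\theta_j\|_2\ne0)$ is the number of nonzero columns. $\mathbb{B}^d_0(s_0)=\{\eta\in\mathbb{R}^d:\sum_i\mathbb{I}(\eta_i\neq0)\le s_0\}$, and for $q\in(0,1]$, $\mathbb{B}^d_q(R_q)=\{\eta\in\mathbb{R}^d:\sum_i|\eta_i|^q\le R_q\}$. $\Theta^{m,d}_0(s,s_0)=\{\theta\in\mathbb{R}^{d\times m}:\|\theta\|_{0,2}\le s,\ \theta_j\in\mathbb{B}^d_0(s_0)\ \forall j\in[m]\}$; for $q\in(0,1]$, $\Theta^{m,d}_q(s,R_q)=\{\theta\in\mathbb{R}^{d\times m}:\|\theta\|_{0,2}\le s,\ \theta_j\in\mathbb{B}^d_q(R_q)\ \forall j\in[m]\}$. In the displayed suprema, for each $\theta$ the estimator is computed from $\bar Y=\theta+\bar Z$ where $\theta$ is the true parameter; the probability is over the noise. The constants do not depend on $n,m,d,s,s_0,R_q,\epsilon$; $\sigma$ is regarded as fixed, and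 the constants may depend on $\sigma$, and in (b) also on $q,\delta,C_3,C_4$. *)

(* Defs.v *)
From HB Require Export structures.
From mathcomp Require Export all_boot all_order all_algebra.
From mathcomp Require Export all_classical all_reals all_analysis.
Export Order.TTheory GRing.Theory Num.Theory numFieldNormedType.Exports.

Set Implicit Arguments.
Unset Strict Implicit.
Unset Printing Implicit Defensive.

Local Open Scope classical_set_scope.
Local Open Scope ring_scope.

Section norms_and_classes.
Variables (R : realType) (d m : nat).
Implicit Types (eta : 'cV[R]_d) (theta : 'M[R]_(d, m)).

Definition l2norm eta : R := Num.sqrt (\sum_(i < d) eta i 0 ^+ 2).

Definition frobenius theta : R :=
  Num.sqrt (\sum_(i < d) \sum_(j < m) theta i j ^+ 2).

Definition norm02 theta : nat :=
  (\sum_(j < m) (l2norm (col j theta) != 0%R))%N.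

Definition ball0 (s0 : nat) : set 'cV[R]_d :=
  [set eta | (\sum_(i < d) (eta i ord0 != 0%R) <= s0)%N].

Definition ballq (q Rq : R) : set 'cV[R]_d :=
  [set eta | \sum_(i < d) `|eta i 0| `^ q <= Rq].

Definition Theta0 (s s0 : nat) : set 'M[R]_(d, m) :=
  [set theta | (norm02 theta <= s)%N /\ forall j, ball0 s0 (col j theta)].

Definition Thetaq (q : R) (s : nat) (Rq : R) : set 'M[R]_(d, m) :=
  [set theta | (norm02 theta <= s)%N /\ forall j, ballq q Rq (col j theta)].

End norms_and_classes.

Arguments Theta0 : clear implicits.
Arguments Thetaq {R} d m q s Rq.

Definition argmin (R : realType) (T : Type) (A : set T) (f : T -> R) : set T :=
  [set x | A x /\ forall y, A y -> f x <= f y].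

(* A (not necessarily measurable) selection from the argmin set is all that is
   required of a least squares estimator. *)
Definition least_squares (R : realType) (d m : nat) (Theta : set 'M[R]_(d, m))
    (hat : 'M[R]_(d, m) -> 'M[R]_(d, m)) : Prop :=
  forall Y, argmin Theta (fun v => frobenius (Y - v) ^+ 2) (hat Y).

Section probability.
Context (disp : measure_display) (T : measurableType disp) (R : realType)
  (P : probability T R).

Definition mutually_independent (I : finType) (X : I -> {RV P >-> R}) : Prop :=
  forall (J : {set I}) (A : I -> set R), (forall i, measurable (A i)) ->
    P (\bigcap_(i in [set` J]) X i @^-1` A i) =
    (\prod_(i in J) P (X i @^-1` A i))%E.

(* [E] need not be measurable, e.g. when it involves an uncountable supremum
   or an arbitrary selection, so this is about the inner probability of [E];
   for measurable [E] it is just [p%:E < P E]. *)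
Definition holds_with_probability_gt (E : set T) (p : R) : Prop :=
  exists A : set T, [/\ measurable A, A `<=` E & (p%:E < P A)%E].

Section model.
Variables (n d m : nat) (Z : 'I_n -> 'I_d -> 'I_m -> {RV P >-> R}).

(* The second parameter of [normal_prob] is the standard deviation. *)
Definition gaussian_noise (sigma : R) : Prop :=
  mutually_independent
    (fun k : 'I_n * 'I_d * 'I_m => Z k.1.1 k.1.2 k.2) /\
  forall i a b (A : set R), measurable A ->
    distribution P (Z i a b) A = normal_prob 0 sigma A.

Definition noise (i : 'I_n) (w : T) : 'M[R]_(d, m) :=
  \matrix_(a < d, b < m) Z i a b w.

Definition observation (theta : 'M[R]_(d, m)) (i : 'I_n) (w : T) :
  'M[R]_(d, m) := theta + noise i w.

Definition mean_observation (theta : 'M[R]_(d, m)) (w : T) : 'M[R]_(d, m) :=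
  n%:R^-1 *: \sum_(i < n) observation theta i w.

(* For each [theta] in the supremum the data are generated with [theta] as the
   true parameter, the noise realization [w] being common to all of them. *)
Definition sup_risk (Theta : set 'M[R]_(d, m))
    (hat : 'M[R]_(d, m) -> 'M[R]_(d, m)) (w : T) : \bar R :=
  ereal_sup [set (frobenius (hat (mean_observation theta w) - theta) ^+ 2)%:E
            | theta in Theta].

End model.
End probability.

(* Main.v *)
(** Write [X = \sum_i Z_i / (sigma sqrt n)] for the standardized noise and
    [kappa = sigma / sqrt n], so that the averaged noise is [kappa X].  Minimality
    of the estimator gives [|v|^2 <= 2 kappa <X, v>] for its error [v], which has
    at most [2 s] nonzero columns.  With a threshold [tau],
    [2 kappa v x <= 2 kappa tau |v| + v^2 / 4 + 4 kappa^2 (x^2 - tau^2)_+]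
    entrywise; the first term is deterministic, and the last one is controlled
    simultaneously for all supports, without a union bound, by the potential
    [\prod_j (1 + beta \prod_i (1 + alpha exp (X_ij^2 / 4)))] with
    [alpha = exp (- tau^2 / 4)]: up to [ln (1 / beta)] per nonzero column its
    logarithm dominates the sum of the [(x^2 - tau^2)_+ / 4] over these columns.
    Its expectation is computed by expanding [exp (y^2 / 4)] into exponentials
    [exp (k y)], whose joint moments come from independence, and Markov's
    inequality concludes.  One takes [alpha = s0 / (e d)] in the [l_0] case and
    [alpha = 1 / d] in the [l_q] case, and [beta] of order [s / m] up to the
    factor compensating for the inner products. *)

Require Import Defs.
From mathcomp Require Import finmap measurable_realfun ring lra.

Set Implicit Arguments.
Unset Strict Implicit.
Unset Printing Implicit Defensive.

Local Open Scope classical_set_scope.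
Local Open Scope ring_scope.

(** * Densities and independence *)

Section density.
Context d1 d2 (T1 : measurableType d1) (T2 : measurableType d2) (R : realType).
Local Open Scope ereal_scope.

Import HBNNSimple.

(** Both sides are linear in [f] and continuous along increasing sequences, so the identity for
    indicators passes to simple functions and then to their limits. The weight [G] will be a
    Gaussian density or a product of other independent factors. *)
Lemma ge0_integral_density (mu : {measure set T1 -> \bar R})
    (nu : {measure set T2 -> \bar R}) (G : T1 -> R) (Z : T1 -> T2)
    (f : T2 -> R) :
  measurable_fun setT G -> (forall w, (0 <= G w)%R) -> measurable_fun setT Z ->
  measurable_fun setT f -> (forall x, (0 <= f x)%R) ->
  (forall A, measurable A -> \int[mu]_w (G w * \1_A (Z w))%:E = nu A) ->
  \int[mu]_w (G w * f (Z w))%:E = \int[nu]_x (f x)%:E.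
Proof.
move=> mG G0 mZ mf f0 GA.
move/measurable_EFinP: (mf) => mEf.
pose g := nnsfun_approx measurableT mEf.
have mg n : measurable_fun setT (g n \o Z).
  by apply: measurableT_comp => //; exact: measurable_funP.
have cg x : (g n x)%:E @[n --> \oo] --> (f x)%:E.
  by apply: (cvg_nnsfun_approx measurableT mEf) => // y _; rewrite lee_fin.
have step n : \int[mu]_w (G w * g n (Z w))%:E = \int[nu]_x (g n x)%:E.
  pose s := fset_set (range (g n)).
  have gE x : g n x = (\sum_(i < #|`s|) s`_i * \1_(g n @^-1` [set s`_i]) x)%R.
    exact: fimfunEord.
  have s0 (i : 'I_#|`s|) : (0 <= s`_i)%R.
    have : s`_i \in s by exact: mem_nth.
    by rewrite /s in_fset_set; [move=> /set_mem[x _ <-] | exact: fimfunP].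
  have mA (i : 'I_#|`s|) : measurable (g n @^-1` [set s`_i]) by [].
  have mI (i : 'I_#|`s|) :
      measurable_fun setT (fun w => \1_(g n @^-1` [set s`_i]) (Z w) : R).
    by apply: measurableT_comp => //; exact: measurable_indic.
  have -> : \int[mu]_w (G w * g n (Z w))%:E =
      \int[mu]_w \sum_(i < #|`s|)
        ((s`_i)%:E * (G w * \1_(g n @^-1` [set s`_i]) (Z w))%:E).
    apply: eq_integral => w _; rewrite gE mulr_sumr -sumEFin.
    by apply: eq_bigr => i _; rewrite -EFinM mulrCA.
  have -> : \int[nu]_x (g n x)%:E =
      \int[nu]_x \sum_(i < #|`s|)
        ((s`_i)%:E * (\1_(g n @^-1` [set s`_i]) x)%:E).
    apply: eq_integral => w _; rewrite gE -sumEFin.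
    by apply: eq_bigr => i _; rewrite -EFinM.
  rewrite !ge0_integral_sum//; last 4 first.
  - by move=> i; apply: measurable_funeM; exact/measurable_EFinP.
  - by move=> i x _; rewrite -EFinM lee_fin mulr_ge0 // indicE.
  - move=> i; apply: measurable_funeM; apply/measurable_EFinP.
    exact: measurable_funM.
  - by move=> i x _; rewrite -EFinM lee_fin !mulr_ge0 // indicE.
  apply: eq_bigr => i _; rewrite !ge0_integralZl_EFin ?GA//.
  - by rewrite integral_indic// setIT.
  - exact/measurable_EFinP.
  - by move=> w _; rewrite lee_fin mulr_ge0// indicE.
  - by apply/measurable_EFinP; exact: measurable_funM.
have nd x : {homo (fun n => g n x) : a b / (a <= b)%N >-> (a <= b)%R}.
  by move=> a b ab; exact/lefP/nd_nnsfun_approx.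
have cnu : \int[nu]_x (g n x)%:E @[n --> \oo] --> \int[nu]_x (f x)%:E.
  have -> : \int[nu]_x (f x)%:E = \int[nu]_x limn (fun n => (g n x)%:E).
    by apply: eq_integral => w _; apply/esym/cvg_lim => //; exact: cg.
  apply: cvg_monotone_convergence => //.
  - by move=> n; apply/measurable_EFinP.
  - by move=> n w _; rewrite lee_fin.
  - by move=> w _ a b ab; rewrite lee_fin nd.
have cmu : \int[mu]_w (G w * g n (Z w))%:E @[n --> \oo] -->
    \int[mu]_w (G w * f (Z w))%:E.
  have -> : \int[mu]_w (G w * f (Z w))%:E =
      \int[mu]_w limn (fun n => (G w * g n (Z w))%:E).
    apply: eq_integral => w _; apply/esym/cvg_lim => //.
    under eq_fun do rewrite EFinM.
    by rewrite EFinM; apply: cvgeZl => //; exact: cg.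
  apply: cvg_monotone_convergence => //.
  - move=> n; apply/measurable_EFinP; apply: measurable_funM => //; exact: mg.
  - by move=> n w _; rewrite lee_fin mulr_ge0.
  - by move=> w _ a b ab; rewrite lee_fin ler_wpM2l// nd.
move: cmu; under eq_fun do rewrite step.
by move=> cmu; exact: (cvg_unique _ cmu cnu).
Qed.

End density.

Section independence.
Context (disp : measure_display) (T : measurableType disp) (R : realType)
  (P : probability T R).
Local Open Scope ereal_scope.

(** Independence speaks of events, which settles the case of indicator factors. These are exchanged
    for general functions one coordinate at a time, by [ge0_integral_density] with the remaining
    factors as weight. *)
Lemma integral_prod_comp (I : finType) (X : I -> {RV P >-> R})
    (f : I -> R -> R) (e : I -> R) :
  mutually_independent X ->
  (forall i, measurable_fun setT (f i)) -> (forall i x, (0 <= f i x)%R) ->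
  (forall i, \int[P]_w (f i (X i w))%:E = (e i)%:E) ->
  \int[P]_w (\prod_i f i (X i w))%:E = (\prod_i e i)%:E.
Proof.
move=> indX mf f0 fe.
(* [l] lists the coordinates whose factor may be arbitrary; outside [l] all factors are
   indicators. *)
suff H (l : seq I) : forall (f : I -> R -> R) (e : I -> R),
    (forall i, measurable_fun setT (f i)) -> (forall i x, (0 <= f i x)%R) ->
    (forall i, \int[P]_w (f i (X i w))%:E = (e i)%:E) ->
    (forall i, i \notin l -> exists2 A, measurable A & f i = \1_A) ->
    \int[P]_w (\prod_i f i (X i w))%:E = (\prod_i e i)%:E.
  by apply: (H (enum I)) => // i; rewrite mem_enum.
elim: l => [|k l IH] {mf f0 fe}f {}e mf f0 fe fA.
  have /choice [A AP] : forall i, exists A, measurable A /\ f i = \1_A.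
    by move=> i; have [//|A mA fiA] := fA i; exists A.
  have mX i : measurable (X i @^-1` A i).
    by rewrite -[X in measurable X]setTI; apply: measurable_funP => //;
      case: (AP i).
  have {}fe i : P (X i @^-1` A i) = (e i)%:E.
    rewrite -fe; have [_ ->] := AP i.
    by rewrite -[X in P X]setIT -integral_indic.
  have -> : (\prod_i e i)%:E = \prod_(i in [set: I]%SET) P (X i @^-1` A i).
    rewrite (eq_bigr (fun i => (e i)%:E)) => [|i _]; last exact: fe.
    rewrite (big_morph EFin EFinM erefl); apply: eq_bigl => i.
    by rewrite finset.in_setT.
  rewrite -(indX [set: I]%SET A); last by move=> i; case: (AP i).
  rewrite -[X in _ = P X]setIT -integral_indic//; last first.
    by apply: fin_bigcap_measurable => // i _; exact: mX.
  apply: eq_integral => w _; congr EFin.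
  under eq_bigr => i _ do rewrite (AP i).2 indicE.
  rewrite indicE; have [|] := boolP (w \in _) => wA.
    rewrite big1// => i _; rewrite mem_set//.
    by move/set_mem: wA => /(_ i); apply; rewrite /= finset.in_setT.
  have [i wAi] : exists i, ~ A i (X i w).
    apply: contrapT => /forallNP H; move: wA => /negP; apply; apply: mem_set.
    by move=> i _; apply: contrapT; exact: H.
  by rewrite (bigD1 i)//= memNset// mul0r.
have mG : measurable_fun setT (fun w => \prod_(i | i != k) f i (X i w))%R.
  under eq_fun do rewrite -big_filter.
  apply: measurable_prod => i _.
  by apply: measurableT_comp => //; exact: measurable_funP.
transitivity (\int[P]_w ((\prod_(i | i != k) f i (X i w))%R * f k (X k w))%:E).
  by apply: eq_integral => w _; rewrite (bigD1 k)//= mulrC.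
rewrite (bigD1 k)//= mulrC EFinM -fe.
have e0 i : (0 <= e i)%R.
  by rewrite -lee_fin -fe; apply: integral_ge0 => w _; rewrite lee_fin.
(* The product of the other expectations becomes a scalar in front of the law of [X k]; this scaled
   law is the target measure of [ge0_integral_density]. *)
have c0 : (0 <= \prod_(i | i != k) e i)%R by apply: prodr_ge0.
pose c := NngNum c0; rewrite -[(\prod_(i | i != k) e i)%R]/(c%:num).
rewrite -(ge0_integral_distribution (X k) (f := EFin \o f k)); last 2 first.
- exact/measurable_EFinP.
- by move=> x; rewrite lee_fin.
rewrite -ge0_integral_mscale//; last 2 first.
- exact/measurable_EFinP.
- by move=> x _; rewrite lee_fin.
apply: ge0_integral_density => //; first by move=> w; apply: prodr_ge0.
move=> A mA.
pose f' i := if i == k then \1_A else f i.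
pose e' i := if i == k then fine (P (X k @^-1` A)) else e i.
have mXA : measurable (X k @^-1` A).
  by rewrite -[X in measurable X]setTI; exact: measurable_funP.
have PXA : \int[P]_w (\1_A (X k w))%:E = (fine (P (X k @^-1` A)))%:E.
  by rewrite fineK ?fin_num_measure// -[X in P X]setIT -integral_indic.
have prodf' w : (\prod_i f' i (X i w) =
    (\prod_(i | i != k) f i (X i w)) * \1_A (X k w))%R.
  rewrite (bigD1 k)//= {1}/f' eqxx mulrC; congr (_ * _)%R.
  by apply: eq_bigr => i /negPf ik; rewrite /f' ik.
have prode' : (\prod_i e' i =
    (\prod_(i | i != k) e i) * fine (P (X k @^-1` A)))%R.
  rewrite (bigD1 k)//= {1}/e' eqxx mulrC; congr (_ * _)%R.
  by apply: eq_bigr => i /negPf ik; rewrite /e' ik.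
under eq_integral do rewrite -prodf'.
rewrite [RHS](_ : _ = (\prod_i e' i)%:E); last first.
  by rewrite prode' EFinM fineK ?fin_num_measure.
apply: IH.
- by move=> i; rewrite /f'; case: ifP => // _; exact: measurable_indic.
- by move=> i x; rewrite /f'; case: ifP => // _; rewrite indicE.
- by move=> i; rewrite /f' /e'; case: eqP => [->|//].
- move=> i il; rewrite /f'; case: eqP => [_|/eqP ik]; first by exists A.
  by apply: fA; rewrite in_cons negb_or ik.
Qed.

End independence.

(** * Sub-Gaussian noise *)

Section gaussian.
Context (disp : measure_display) (T : measurableType disp) (R : realType)
  (P : probability T R).

(** Completing the square: tilting the centred density by [expR (u * x)] gives a constant times the
    density with mean [u * sigma ^+ 2], whose integral is 1. *)
Lemma normal_mgf (sigma : R) (X : {RV P >-> R}) :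
  0 < sigma ->
  (forall A, measurable A -> distribution P X A = normal_prob 0 sigma A) ->
  forall u, (\int[P]_w (expR (u * X w))%:E = (expR (u ^+ 2 * sigma ^+ 2 / 2))%:E)%E.
Proof.
move=> s0 dX u.
have mexp : measurable_fun setT (fun x : R => expR (u * x)).
  by apply: measurableT_comp => //; exact: measurable_funM.
have tilt (x : R) : normal_pdf 0 sigma x * expR (u * x) =
    expR (u ^+ 2 * sigma ^+ 2 / 2) * normal_pdf (u * sigma ^+ 2) sigma x.
  rewrite !normal_pdfE ?gt_eqF// -[LHS]mulrA [RHS]mulrCA /normal_fun -!expRD.
  congr (_ * expR _); rewrite -(mulr_natr (sigma ^+ 2)); field.
  by rewrite gt_eqF.
rewrite -(ge0_integral_distribution X (f := fun x => (expR (u * x))%:E));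
  last 2 first.
- exact/measurable_EFinP.
- by move=> x; rewrite lee_fin expR_ge0.
rewrite -(@ge0_integral_density _ _ _ _ _ lebesgue_measure (distribution P X)
  (normal_pdf 0 sigma) idfun (fun x => expR (u * x)))//=.
- have -> : (fun x => (normal_pdf 0 sigma x * expR (u * x))%:E) =
      (fun x => (expR (u ^+ 2 * sigma ^+ 2 / 2))%:E *
                (normal_pdf (u * sigma ^+ 2) sigma x)%:E)%E.
    apply/funext => x; rewrite -EFinM; congr EFin.
    exact: tilt.
  rewrite ge0_integralZl_EFin ?expR_ge0//.
  + by rewrite integral_normal_pdf mule1.
  + by move=> x _; rewrite lee_fin normal_pdf_ge0.
  + apply/measurable_EFinP; exact: measurable_normal_pdf.
- exact: measurable_normal_pdf.
- exact: normal_pdf_ge0.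
- exact: measurable_id.
- move=> A mA; rewrite dX// /normal_prob [RHS]integral_mkcond.
  apply: eq_integral => x _; rewrite patchE indicE.
  by case: ifP; rewrite ?mulr1 ?mulr0.
Qed.

(** The bound on all linear combinations at once carries independence and unit variance together:
    freezing some coefficients and varying another drives the inductions below. *)
Definition subgaussian (I : finType) (X : I -> T -> R) :=
  (forall k, measurable_fun setT (X k)) /\
  forall v : I -> R, (\int[P]_w (expR (\sum_k v k * X k w))%:E <=
     (expR (\sum_k v k ^+ 2 / 2))%:E)%E.

Definition standardized_noise n d m (sigma : R)
    (Z : 'I_n -> 'I_d -> 'I_m -> {RV P >-> R}) (k : 'I_d * 'I_m) (w : T) : R :=
  (sigma * Num.sqrt n%:R)^-1 * \sum_i Z i k.1 k.2 w.

Lemma big_prod3 (A : Type) (idx : A) (op : Monoid.com_law idx)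
    (I J K : finType) (F : I * J * K -> A) :
  \big[op/idx]_k F k = \big[op/idx]_(p : J * K) \big[op/idx]_i F (i, p.1, p.2).
Proof.
rewrite exchange_big pair_bigA /=.
rewrite (reindex (fun q : I * (J * K) => (q.1, q.2.1, q.2.2))) //.
by exists (fun q => (q.1.1, (q.1.2, q.2))) => [[? []]|[[]]].
Qed.

(** The exponential moment factors over all entries of all noise matrices, and the scaling makes the
    [n] copies at a position add up to [v k ^+ 2 / 2]. *)
Lemma subgaussian_noise n d m (sigma : R)
    (Z : 'I_n -> 'I_d -> 'I_m -> {RV P >-> R}) :
  0 < sigma -> (0 < n)%N -> gaussian_noise Z sigma ->
  subgaussian (standardized_noise sigma Z).
Proof.
move=> s0 n0 [indZ dZ]; split.
  move=> k; apply: measurable_funM => //; apply: measurable_sum => i.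
  exact: measurable_funP.
move=> v; pose c := (sigma * Num.sqrt n%:R)^-1.
pose f (k : 'I_n * 'I_d * 'I_m) x := expR (v (k.1.2, k.2) * c * x).
pose e (k : 'I_n * 'I_d * 'I_m) :=
  expR ((v (k.1.2, k.2) * c) ^+ 2 * sigma ^+ 2 / 2).
have mf k : measurable_fun setT (f k).
  by apply: measurableT_comp => //; exact: measurable_funM.
have -> : (\int[P]_w (expR (\sum_k v k * standardized_noise sigma Z k w))%:E =
    \int[P]_w (\prod_k f k (Z k.1.1 k.1.2 k.2 w))%:E)%E.
  apply: eq_integral => w _; congr EFin.
  rewrite -expR_sum; congr expR; rewrite [RHS]big_prod3.
  apply: eq_bigr => -[a b] _; rewrite /standardized_noise -/c /= !mulr_sumr.
  by apply: eq_bigr => i _; rewrite mulrA.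
rewrite (integral_prod_comp (e := e) indZ mf); last 2 first.
- by move=> k x; exact: expR_ge0.
- by move=> k; apply: normal_mgf => // A mA; exact: dZ.
rewrite lee_fin -expR_sum ler_expR [leLHS]big_prod3.
apply: ler_sum => -[a b] _; rewrite /e /c /= sumr_const card_ord.
have nn : Num.sqrt n%:R ^+ 2 = n%:R :> R by rewrite sqr_sqrtr.
have np : Num.sqrt n%:R != 0 :> R by rewrite gt_eqF// sqrtr_gt0 ltr0n.
rewrite -[leLHS]mulr_natr; set r := Num.sqrt _ in nn np *.
rewrite -nn le_eqVlt; apply/orP; left; apply/eqP; field.
by rewrite np gt_eqF.
Qed.

End gaussian.

(** * Squared exponentials *)

Section squares.
Context (disp : measure_display) (T : measurableType disp) (R : realType)
  (P : probability T R).

(** The sum over [k] of [2 * expR (1 - k ^ 2 / 2)], once [k ^ 2] is lowered to [k], is a geometric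
    series with this value. It caps the expectation of [expR (x ^ 2 / 4)] for a standardized entry
    [x]. *)
Definition sqexp_const : R := 2 * expR 1 / (1 - expR (- 2^-1)).

Lemma sqexp_const_gt0 : 0 < sqexp_const.
Proof.
have h : expR (- 2^-1) < 1 :> R by rewrite expR_lt1; lra.
by rewrite divr_gt0 ?subr_gt0// mulr_gt0 ?expR_gt0.
Qed.

(** The exponentials cost [expR (k ^ 2 / 2)] in expectation, against which the weight
    [expR (1 - k ^ 2)] stays summable. Its factor [expR 1] pays for rounding [|y| / 2] down to an
    integer. *)
Definition cosh_term (k : nat) (y : R) : R :=
  expR (1 - k%:R ^+ 2) * (expR (k%:R * y) + expR (- (k%:R) * y)).

Lemma cosh_term_ge0 k y : 0 <= cosh_term k y.
Proof. by rewrite mulr_ge0 ?addr_ge0 ?expR_ge0. Qed.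

(* The term [k = floor (|y| / 2)] alone suffices, because
   [y ^ 2 / 4 - k |y| + k ^ 2 = (|y| / 2 - k) ^ 2]. *)
Lemma expR_sqr_le_series (y : R) :
  ((expR (y ^+ 2 / 4))%:E <= \sum_(0 <= k <oo) (cosh_term k y)%:E)%E.
Proof.
pose k := Num.trunc (`|y| / 2).
apply: (@le_trans _ _ (\sum_(0 <= i < k.+1) (cosh_term i y)%:E)%E); last first.
  by apply: nneseries_lim_ge => i _ _; rewrite lee_fin cosh_term_ge0.
rewrite big_nat_recr//=; apply: (@le_trans _ _ (cosh_term k y)%:E); last first.
  by rewrite leeDr// sume_ge0// => i _; rewrite lee_fin cosh_term_ge0.
have /andP[k1 k2] : k%:R <= `|y| / 2 < k.+1%:R.
  by apply: truncn_itv; rewrite divr_ge0.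
rewrite lee_fin /cosh_term.
apply: (@le_trans _ _ (expR (1 - k%:R ^+ 2) * expR (k%:R * `|y|))); last first.
  rewrite ler_pM2l ?expR_gt0//; case: (ger0P y) => _.
    by rewrite lerDl expR_ge0.
  by rewrite mulrN mulNr lerDr expR_ge0.
rewrite -expRD ler_expR -[y ^+ 2]real_normK ?num_real//.
suff H (a b : R) : b <= a / 2 -> a / 2 < b + 1 ->
    a ^+ 2 / 4 <= 1 - b ^+ 2 + b * a by apply: H => //; rewrite natr1.
move=> ba ab; have h1 : 0 <= 1 - (a / 2 - b) by lra.
have h2 : 0 <= 1 + (a / 2 - b) by lra.
by have := mulr_ge0 h1 h2; lra.
Qed.

Lemma series_cosh_term_le (c : R) : 0 <= c ->
  (\sum_(0 <= k <oo) (2 * c * expR (1 - k%:R ^+ 2 / 2))%:E <=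
    (c * sqexp_const)%:E)%E.
Proof.
move=> c0; apply: lime_le.
  apply: is_cvg_nneseries => n _ _.
  by rewrite lee_fin !mulr_ge0 ?expR_ge0.
apply: nearW => n; rewrite sumEFin lee_fin.
have h : expR (- 2^-1) < 1 :> R by rewrite expR_lt1; lra.
set r := expR (- 2^-1) in h *.
have geo : \sum_(0 <= k < n) r ^+ k <= (1 - r)^-1.
  rewrite -[leRHS]div1r ler_pdivlMr ?subr_gt0// big_mkord mulrC.
  have -> : (1 - r) * \sum_(k < n) r ^+ k = 1 - r ^+ n.
    by have := subrX1 r n; lra.
  by rewrite lerBlDr lerDl exprn_ge0 ?expR_ge0.
apply: (@le_trans _ _ (2 * c * expR 1 * \sum_(0 <= k < n) r ^+ k)); last first.
  rewrite /sqexp_const [leRHS](_ : _ = 2 * c * expR 1 * (1 - r)^-1); last by ring.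
  by rewrite ler_wpM2l// !mulr_ge0 ?expR_ge0.
rewrite mulr_sumr; apply: ler_sum => k _; rewrite -[leRHS]mulrA.
rewrite ler_wpM2l ?mulr_ge0// -expRM_natl -expRD ler_expR.
have : k%:R <= k%:R ^+ 2 :> R.
  by rewrite -natrX ler_nat; case: k => // k; rewrite expnS expn1 leq_pmull.
by rewrite mulrN; lra.
Qed.

(** Dominating the squared exponential by the series of [cosh_term] reduces the claim to the assumed
    moments, term by term. The weight [F] allows entries to be treated one after another. *)
Lemma integral_mul_expR_sqr (F X : T -> R) (c : R) :
  measurable_fun setT F -> (forall w, 0 <= F w) -> measurable_fun setT X ->
  0 <= c ->
  (forall u : R, (\int[P]_w (F w * expR (u * X w))%:E <=
     (c * expR (u ^+ 2 / 2))%:E)%E) ->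
  (\int[P]_w (F w * expR (X w ^+ 2 / 4))%:E <= (c * sqexp_const)%:E)%E.
Proof.
move=> mF F0 mX c0 H.
have mexp u : measurable_fun setT (fun w => F w * expR (u * X w)).
  apply: measurable_funM => //; apply: measurableT_comp => //.
  exact: measurable_funM.
have mt k : measurable_fun setT (fun w => F w * cosh_term k (X w)).
  have -> : (fun w => F w * cosh_term k (X w)) =
      (fun w => expR (1 - k%:R ^+ 2) *
        (F w * expR (k%:R * X w) + F w * expR (- k%:R * X w))).
    by apply/funext => w; rewrite /cosh_term; ring.
  by apply: measurable_funM => //; exact: measurable_funD.
apply: le_trans (series_cosh_term_le c0).
apply: (@le_trans _ _
    (\int[P]_w \sum_(0 <= k <oo) (F w * cosh_term k (X w))%:E)%E).
  apply: ge0_le_integral => //.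
  - by move=> w _; rewrite lee_fin mulr_ge0 ?expR_ge0.
  - apply/measurable_EFinP; apply: measurable_funM => //.
    apply: measurableT_comp => //; apply: measurable_funM => //.
    exact: measurable_funX.
  - apply: ge0_emeasurable_sum => k.
    + by move=> w _ _; rewrite lee_fin mulr_ge0 ?cosh_term_ge0.
    + by move=> _; exact/measurable_EFinP.
  - move=> w _.
    under eq_eseriesr do rewrite EFinM.
    rewrite nneseriesZl; last by move=> k _; rewrite lee_fin cosh_term_ge0.
    by rewrite EFinM lee_wpmul2l ?lee_fin ?expR_sqr_le_series.
rewrite integral_nneseries//; last 2 first.
- by move=> k; exact/measurable_EFinP.
- by move=> k w _; rewrite lee_fin mulr_ge0 ?cosh_term_ge0.
apply: lee_nneseries => [k _ _|k _].
  by apply: integral_ge0 => w _; rewrite lee_fin mulr_ge0 ?cosh_term_ge0.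
have -> : (\int[P]_w (F w * cosh_term k (X w))%:E =
    \int[P]_w ((expR (1 - k%:R ^+ 2))%:E *
      ((F w * expR (k%:R * X w))%:E + (F w * expR (- k%:R * X w))%:E)))%E.
  apply: eq_integral => w _; rewrite -EFinD -EFinM; congr EFin.
  by rewrite /cosh_term; ring.
have ge0 u w : (0 <= (F w * expR (u * X w))%:E)%E.
  by rewrite lee_fin mulr_ge0 ?expR_ge0.
have mE u : measurable_fun setT (fun w => (F w * expR (u * X w))%:E).
  exact/measurable_EFinP.
rewrite ge0_integralZl_EFin ?expR_ge0//; last 2 first.
- by move=> w _; rewrite adde_ge0.
- exact: emeasurable_funD.
rewrite ge0_integralD//.
apply: (@le_trans _ _ ((expR (1 - k%:R ^+ 2))%:E *
    ((c * expR (k%:R ^+ 2 / 2))%:E + (c * expR ((- k%:R) ^+ 2 / 2))%:E))%E).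
  by rewrite lee_wpmul2l ?lee_fin ?expR_ge0// leeD.
rewrite -EFinD -EFinM lee_fin sqrrN.
have -> : expR (1 - k%:R ^+ 2 / 2) =
    expR (1 - k%:R ^+ 2) * expR (k%:R ^+ 2 / 2) :> R.
  by rewrite -expRD; congr expR; field.
by rewrite le_eqVlt; apply/orP; left; apply/eqP; ring.
Qed.

End squares.

(** * Expectation of products over entries and columns *)

Section polynomial.
Context (disp : measure_display) (T : measurableType disp) (R : realType)
  (P : probability T R).
Variables (I : finType) (X : I -> T -> R).
Hypothesis sgX : subgaussian P X.
Variables (alpha beta : R).
Hypotheses (alpha0 : 0 <= alpha) (beta0 : 0 <= beta).

Let mX k : measurable_fun setT (X k) := sgX.1 k.

Definition sqexp (i : I) (w : T) : R := expR (X i w ^+ 2 / 4).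

Definition block_prod (l : seq I) (w : T) : R :=
  \prod_(i <- l) (1 + alpha * sqexp i w).

Definition blocks_prod (bs : seq (seq I)) (w : T) : R :=
  \prod_(b <- bs) (1 + beta * block_prod b w).

Let msqexp i : measurable_fun setT (sqexp i).
Proof.
apply: measurableT_comp => //; apply: measurable_funM => //.
exact: measurable_funX.
Qed.

Lemma measurable_block_prod l : measurable_fun setT (block_prod l).
Proof.
apply: measurable_prod => i _; apply: measurable_funD => //.
exact: measurable_funM.
Qed.

Lemma measurable_blocks_prod bs : measurable_fun setT (blocks_prod bs).
Proof.
apply: measurable_prod => b _; apply: measurable_funD => //.
by apply: measurable_funM => //; exact: measurable_block_prod.
Qed.

Lemma block_prod_ge0 l w : 0 <= block_prod l w.
Proof.
by apply: prodr_ge0 => i _; rewrite addr_ge0// mulr_ge0 ?expR_ge0.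
Qed.

Lemma blocks_prod_ge0 bs w : 0 <= blocks_prod bs w.
Proof.
by apply: prodr_ge0 => b _; rewrite addr_ge0// mulr_ge0 ?block_prod_ge0.
Qed.

Local Notation g := (1 + alpha * sqexp_const R).

Let g0 : 0 <= g. Proof. by rewrite addr_ge0// mulr_ge0// ltW// sqexp_const_gt0. Qed.

Let ge0_integral_1D (F G : T -> R) (a c e : R) :
  measurable_fun setT F -> (forall w, 0 <= F w) ->
  measurable_fun setT G -> (forall w, 0 <= G w) -> 0 <= a ->
  (\int[P]_w (F w)%:E <= c%:E)%E -> (\int[P]_w (G w)%:E <= e%:E)%E ->
  (\int[P]_w (F w + a * G w)%:E <= (c + a * e)%:E)%E.
Proof.
move=> mF F0 mG G0 a0 Fc Ge.
have -> : (\int[P]_w (F w + a * G w)%:E =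
    \int[P]_w ((F w)%:E + a%:E * (G w)%:E))%E.
  by apply: eq_integral => w _; rewrite EFinD EFinM.
rewrite ge0_integralD//; last 4 first.
- by move=> w _; rewrite lee_fin.
- exact/measurable_EFinP.
- by move=> w _; rewrite mule_ge0 ?lee_fin.
- by apply: measurable_funeM; exact/measurable_EFinP.
rewrite ge0_integralZl_EFin//; last 2 first.
- by move=> w _; rewrite lee_fin.
- exact/measurable_EFinP.
by rewrite EFinD EFinM leeD// lee_wpmul2l// lee_fin.
Qed.

(** The tilt [v] off [l] makes the induction work: peeling off [k] leaves a squared exponential of
    [X k], hence exponentials [expR (u * X k)], which the tilt absorbs by giving [k] the coefficient
    [u]. *)
Lemma integral_block_prod_tilted (l : seq I) : uniq l ->
  forall v : I -> R, (forall i, i \in l -> v i = 0) ->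
  (\int[P]_w (expR (\sum_i v i * X i w) * block_prod l w)%:E <=
    (expR (\sum_i v i ^+ 2 / 2) * g ^+ size l)%:E)%E.
Proof.
elim: l => [_ v _|k l IH /= /andP[kl ul] v vl].
  rewrite mulr1; under eq_integral do rewrite /block_prod big_nil mulr1.
  exact: sgX.2.
pose F w := expR (\sum_i v i * X i w) * block_prod l w.
have mF : measurable_fun setT F.
  apply: measurable_funM; last exact: measurable_block_prod.
  apply: measurableT_comp => //; apply: measurable_sum => i.
  exact: measurable_funM.
have F0 w : 0 <= F w by rewrite mulr_ge0 ?expR_ge0 ?block_prod_ge0.
pose c := expR (\sum_i v i ^+ 2 / 2) * g ^+ size l.
have c0 : 0 <= c by rewrite mulr_ge0 ?expR_ge0 ?exprn_ge0.
have -> : (\int[P]_w (expR (\sum_i v i * X i w) * block_prod (k :: l) w)%:E =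
    \int[P]_w (F w + alpha * (F w * sqexp k w))%:E)%E.
  apply: eq_integral => w _; congr EFin.
  by rewrite /block_prod big_cons /F /block_prod; ring.
have -> : expR (\sum_i v i ^+ 2 / 2) * g ^+ (size l).+1 =
    c + alpha * (c * sqexp_const R) by rewrite /c exprS; ring.
apply: ge0_integral_1D => //.
- exact: measurable_funM.
- by move=> w; rewrite mulr_ge0 ?expR_ge0.
- by apply: IH => // i il; apply: vl; rewrite in_cons il orbT.
apply: integral_mul_expR_sqr => // u.
pose v' i := if i == k then u else v i.
have vk : v k = 0 by apply: vl; rewrite mem_head.
have -> : (\int[P]_w (F w * expR (u * X k w))%:E =
    \int[P]_w (expR (\sum_i v' i * X i w) * block_prod l w)%:E)%E.
  apply: eq_integral => w _; congr EFin.
  rewrite /F mulrAC -expRD; congr (expR _ * _).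
  rewrite (bigD1 k)//= [RHS](bigD1 k)//= {1}/v' eqxx vk mul0r add0r addrC.
  by congr (_ + _); apply: eq_bigr => i /negPf ik; rewrite /v' ik.
have -> : c * expR (u ^+ 2 / 2) = expR (\sum_i v' i ^+ 2 / 2) * g ^+ size l.
  rewrite /c mulrAC -expRD; congr (expR _ * _).
  rewrite (bigD1 k)//= [RHS](bigD1 k)//= {1}/v' eqxx vk expr0n mul0r add0r addrC.
  by congr (_ + _); apply: eq_bigr => i /negPf ik; rewrite /v' ik.
apply: IH => // i il; rewrite /v'; case: eqP => [ik|_].
  by move: kl; rewrite -ik il.
by apply: vl; rewrite in_cons il orbT.
Qed.

(** Expanding the first factor either drops its block or appends the block to [l]; generality in [l]
    covers both, and disjointness of the blocks keeps the list free of repetitions. *)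
Lemma integral_blocks_prod (bs : seq (seq I)) :
  forall l, uniq (l ++ flatten bs) ->
  (\int[P]_w (block_prod l w * blocks_prod bs w)%:E <=
    (g ^+ size l * \prod_(b <- bs) (1 + beta * g ^+ size b))%:E)%E.
Proof.
elim: bs => [|b bs IH] l /=.
  rewrite cats0 => ul; rewrite big_nil mulr1.
  under eq_integral do rewrite /blocks_prod big_nil mulr1.
  have := @integral_block_prod_tilted l ul (fun=> 0) (fun _ _ => erefl).
  under [X in (X <= _)%E -> _]eq_integral do
    (under eq_bigr do rewrite mul0r; rewrite big1// expR0 mul1r).
  under eq_bigr do rewrite expr0n mul0r.
  by rewrite big1// expR0 mul1r.
move=> u; have -> : (\int[P]_w (block_prod l w * blocks_prod (b :: bs) w)%:E =
    \int[P]_w (block_prod l w * blocks_prod bs w +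
      beta * (block_prod (l ++ b) w * blocks_prod bs w))%:E)%E.
  apply: eq_integral => w _; congr EFin.
  have -> : block_prod (l ++ b) w = block_prod l w * block_prod b w.
    by rewrite /block_prod big_cat.
  have -> : blocks_prod (b :: bs) w =
      (1 + beta * block_prod b w) * blocks_prod bs w.
    by rewrite /blocks_prod big_cons.
  by ring.
rewrite big_cons (_ : _ * _ =
  g ^+ size l * (\prod_(j <- bs) (1 + beta * g ^+ size j)) +
  beta * (g ^+ size (l ++ b) * \prod_(j <- bs) (1 + beta * g ^+ size j)));
  last by rewrite size_cat exprD; ring.
have m l' : measurable_fun setT (fun w => block_prod l' w * blocks_prod bs w).
  apply: measurable_funM; first exact: measurable_block_prod.
  exact: measurable_blocks_prod.
have p0 l' w : 0 <= block_prod l' w * blocks_prod bs w.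
  by rewrite mulr_ge0 ?block_prod_ge0 ?blocks_prod_ge0.
apply: ge0_integral_1D => //; apply: IH.
  by apply: subseq_uniq u; rewrite cat_subseq// suffix_subseq.
by rewrite -catA.
Qed.

End polynomial.

(** * Tail of the potential *)

Section tail.
Context (disp : measure_display) (T : measurableType disp) (R : realType)
  (P : probability T R).
Variables (d m : nat) (X : 'I_d * 'I_m -> T -> R).
Hypothesis sgX : subgaussian P X.
Variables (alpha beta : R).
Hypotheses (alpha0 : 0 <= alpha) (beta0 : 0 <= beta).

Definition columns : seq (seq ('I_d * 'I_m)) :=
  [seq [seq (i, j) | i <- enum 'I_d] | j <- enum 'I_m].

Definition potential : T -> R := blocks_prod X alpha beta columns.

Lemma potentialE w : potential w =
  \prod_(j < m) (1 + beta * \prod_(i < d) (1 + alpha * sqexp X (i, j) w)).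
Proof.
rewrite /potential /blocks_prod /columns big_map big_enum.
by apply: eq_bigr => j _; rewrite /block_prod big_map big_enum.
Qed.

Lemma uniq_columns : uniq (flatten columns).
Proof.
suff -> : flatten columns =
    [seq (i, j) | j <- enum 'I_m, i <- enum 'I_d] by
  apply: allpairs_uniq; rewrite ?enum_uniq// => -[j i] [j' i'] _ _ [-> ->].
by [].
Qed.

(** [1 + x <= expR x] is used twice: over the [d] entries of a column, giving [expR h], then over
    the [m] columns, giving [expR s]. *)
Lemma integral_potential (h s : R) :
  alpha * sqexp_const R * d%:R <= h -> beta * expR h * m%:R <= s ->
  (\int[P]_w (potential w)%:E <= (expR s)%:E)%E.
Proof.
move=> ah bs.
have := @integral_blocks_prod _ _ _ P _ _ sgX _ _ alpha0 beta0 columns [::]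
  uniq_columns.
under eq_integral do rewrite {1}/block_prod big_nil mul1r.
move=> /le_trans; apply; rewrite lee_fin expr0 mul1r big_map big_enum/=.
under eq_bigr do rewrite size_map size_enum_ord.
have g0 := ltW (sqexp_const_gt0 R).
have gd : (1 + alpha * sqexp_const R) ^+ d <= expR h.
  apply: (@le_trans _ _ (expR (alpha * sqexp_const R) ^+ d)).
    by rewrite lerXn2r ?nnegrE ?expR_ge0 ?addr_ge0 ?mulr_ge0// expR_ge1Dx.
  by rewrite -expRM_natl ler_expR mulrC.
rewrite prodr_const card_ord.
apply: (@le_trans _ _ (expR (beta * expR h) ^+ m)); last first.
  by rewrite -expRM_natl ler_expR mulrC.
rewrite lerXn2r ?nnegrE ?expR_ge0//.
  by rewrite addr_ge0// mulr_ge0// exprn_ge0// addr_ge0 ?mulr_ge0.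
by apply: le_trans (expR_ge1Dx _); rewrite lerD2l ler_wpM2l.
Qed.

(** Markov's inequality. Measurability is recorded because [holds_with_probability_gt] asks for a
    measurable event. *)
Lemma potential_tail (h s u : R) :
  alpha * sqexp_const R * d%:R <= h -> beta * expR h * m%:R <= s ->
  measurable [set w | potential w <= expR u] /\
  ((1 - expR (s - u))%:E <= P [set w | (potential w <= expR u)%R])%E.
Proof.
move=> ah bs.
have mQ : measurable_fun setT potential by exact: (measurable_blocks_prod sgX).
have Q0 w : 0 <= potential w by exact: blocks_prod_ge0.
have mA : measurable [set w | potential w <= expR u].
  rewrite -[X in measurable X]setTI.
  have -> : [set w | potential w <= expR u] = potential @^-1` `]-oo, expR u].
    by apply/seteqP; split => w /=; rewrite in_itv.
  exact: mQ.
split => //; pose B := ~` [set w | potential w <= expR u].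
have mB : measurable B by exact: measurableC.
have PB : (P B <= (expR (s - u))%:E)%E.
  have : ((expR u)%:E * P B <= (expR s)%:E)%E.
    apply: le_trans (integral_potential ah bs).
    rewrite -[X in P X]setIT -integral_indic// -ge0_integralZl_EFin ?expR_ge0//.
      apply: ge0_le_integral => //.
      + apply: measurable_funeM; apply/measurable_EFinP; exact: measurable_indic.
      + exact/measurable_EFinP.
      + move=> w _; rewrite -EFinM lee_fin indicE; have [|] := boolP (w \in B).
          by move/set_mem => /= /negP; rewrite -ltNge mulr1 => /ltW.
        by rewrite mulr0.
    by apply/measurable_EFinP; exact: measurable_indic.
  rewrite -(@fineK _ (P B)) ?fin_num_measure// -EFinM !lee_fin expRB.
  by rewrite ler_pdivlMr ?expR_gt0// mulrC.
have -> : [set w | potential w <= expR u] = ~` B by rewrite setCK.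
rewrite probability_setC// EFinB leeB//.
Qed.

End tail.

(** * Deterministic inequalities for sparse matrices and least squares *)

Section deterministic.
Variable R : realType.

(** The logarithm [L] dominates the positive part of [(x ^ 2 - tau ^ 2) / 4]. Beyond the threshold,
    the excess [|x| - tau] has square at most [4 * L], and the inequality between means gives [2
    kappa |a| (|x| - tau) <= a ^ 2 / 4 + 4 kappa ^ 2 (|x| - tau) ^ 2], whence the factor 16. *)
Lemma entry_bound (kappa tau a x : R) : 0 < kappa -> 0 <= tau ->
  2 * kappa * a * x <= 2 * kappa * tau * `|a| + a ^+ 2 / 4
    + 16 * kappa ^+ 2 * ln (1 + expR (- (tau ^+ 2 / 4)) * expR (x ^+ 2 / 4)).
Proof.
move=> k0 t0; rewrite -expRD.
set L := ln _; have L0 : 0 <= L by rewrite ln_ge0// lerDl expR_ge0.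
have Lx : (x ^+ 2 - tau ^+ 2) / 4 <= L.
  rewrite -[leLHS]expRK ler_ln ?posrE ?expR_gt0// ?ltr_wpDr ?expR_ge0//.
  rewrite (_ : (x ^+ 2 - tau ^+ 2) / 4 = - (tau ^+ 2 / 4) + x ^+ 2 / 4);
    last by ring.
  by rewrite lerDr.
have ax : 2 * kappa * a * x <= 2 * kappa * `|a| * `|x|.
  have := ler_norm (a * x); rewrite normrM => ax.
  by rewrite -!(mulrA (2 * kappa)) ler_wpM2l// mulr_ge0// ltW.
apply: le_trans ax _.
have -> : a ^+ 2 = `|a| ^+ 2 by rewrite real_normK ?num_real.
have {Lx} : (`|x| ^+ 2 - tau ^+ 2) / 4 <= L by rewrite real_normK ?num_real.
suff H (b y : R) : 0 <= b -> 0 <= y -> (y ^+ 2 - tau ^+ 2) / 4 <= L ->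
    2 * kappa * b * y <= 2 * kappa * tau * b + b ^+ 2 / 4 + 16 * kappa ^+ 2 * L.
  by move=> Lx; exact: H.
move=> b0 y0 Lx; have [yt|ty] := leP y tau.
  have : 2 * kappa * b * y <= 2 * kappa * b * tau.
    by rewrite ler_wpM2l// !mulr_ge0// ltW.
  by have := sqr_ge0 b; have := mulr_ge0 (sqr_ge0 kappa) L0; lra.
have Ly : (y - tau) ^+ 2 <= 4 * L.
  have : 0 <= tau * (y - tau) by rewrite mulr_ge0// subr_ge0 ltW.
  by lra.
have : kappa ^+ 2 * (y - tau) ^+ 2 <= kappa ^+ 2 * (4 * L).
  by rewrite ler_wpM2l ?sqr_ge0.
by have := sqr_ge0 (b / 2 - 2 * (kappa * (y - tau))); lra.
Qed.

Definition colsupp d m (v : 'M[R]_(d, m)) : {set 'I_m} :=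
  [set j | l2norm (col j v) != 0]%SET.

Lemma colsupp_notin d m (v : 'M[R]_(d, m)) j i : j \notin colsupp v -> v i j = 0.
Proof.
rewrite finset.inE negbK /l2norm sqrtr_eq0 => h.
have := le_anti (introT andP (conj h _)).
have s0 : 0 <= \sum_(i < d) col j v i 0 ^+ 2.
  by apply: sumr_ge0 => k _; exact: sqr_ge0.
move=> /(_ s0) /eqP; rewrite psumr_eq0; last by move=> k _; exact: sqr_ge0.
by move/allP => /(_ i); rewrite mem_index_enum sqrf_eq0 mxE => /(_ isT)/eqP.
Qed.

Lemma norm02E d m (v : 'M[R]_(d, m)) : norm02 v = #|colsupp v|.
Proof.
rewrite /norm02 -sum1_card [RHS]big_mkcond/=; apply: eq_bigr => j _.
by rewrite finset.inE; case: (_ != _).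
Qed.

Lemma norm02B d m (u v : 'M[R]_(d, m)) :
  (norm02 (u - v) <= norm02 u + norm02 v)%N.
Proof.
rewrite !norm02E; apply: leq_trans (leq_card_setU _ _).1.
apply: subset_leq_card; apply/fintype.subsetP => j; apply: contraLR.
rewrite finset.inE negb_or => /andP[uj vj].
rewrite finset.inE negbK /l2norm big1 ?sqrtr0// => i _.
by rewrite !mxE (colsupp_notin i uj) (colsupp_notin i vj) subr0 expr0n.
Qed.

Lemma frobenius_sqr d m (v : 'M[R]_(d, m)) :
  frobenius v ^+ 2 = \sum_(i < d) \sum_(j < m) v i j ^+ 2.
Proof.
rewrite sqr_sqrtr//; do 2 apply: sumr_ge0 => ? _; exact: sqr_ge0.
Qed.

(** Comparing the objective at the estimator with its value at [theta] gives
    [|N - v| ^ 2 <= |N| ^ 2] for the error [v], and the squared norm of [N] cancels. *)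
Lemma least_squares_basic d m (Theta : set 'M[R]_(d, m)) hat theta N :
  least_squares Theta hat -> Theta theta ->
  frobenius (hat (theta + N) - theta) ^+ 2 <=
    2 * \sum_(i < d) \sum_(j < m) N i j * (hat (theta + N) - theta) i j.
Proof.
move=> lsq Ttheta; have [_ /(_ _ Ttheta)] := lsq (theta + N).
set v := hat _ - theta.
have -> : theta + N - hat (theta + N) = N - v by rewrite /v opprB addrCA addrA.
have -> : theta + N - theta = N by rewrite addrAC subrr add0r.
rewrite !frobenius_sqr -subr_ge0 -sumrB => H; rewrite -subr_ge0.
rewrite mulr_sumr -sumrB; apply: le_trans H _.
apply: ler_sum => i _; rewrite mulr_sumr -!sumrB; apply: ler_sum => j _.
by rewrite !mxE; lra.
Qed.

(* [1 / beta] is the price paid for each of the at most [s] nonzero columns,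
   which turns the factor of the column into one of the potential. *)
Lemma sparse_noise_bound d m (v : 'M[R]_(d, m)) (x : 'I_d -> 'I_m -> R)
    (s : nat) (kappa tau beta u : R) :
  0 < kappa -> 0 <= tau -> 0 < beta <= 1 ->
  (norm02 v <= s)%N ->
  \prod_(j < m) (1 + beta * \prod_(i < d)
    (1 + expR (- (tau ^+ 2 / 4)) * expR (x i j ^+ 2 / 4))) <= expR u ->
  2 * kappa * \sum_(i < d) \sum_(j < m) v i j * x i j <=
    2 * kappa * tau * (\sum_(i < d) \sum_(j < m) `|v i j|)
    + (\sum_(i < d) \sum_(j < m) v i j ^+ 2) / 4
    + 16 * kappa ^+ 2 * (s%:R * - ln beta + u).
Proof.
move=> k0 t0 /andP[b0 b1] vs Qu.
pose J := colsupp v.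
pose C i j := 1 + expR (- (tau ^+ 2 / 4)) * expR (x i j ^+ 2 / 4).
have C1 i j : 1 <= C i j by rewrite lerDl mulr_ge0 ?expR_ge0.
have C0 i j : 0 < C i j by exact: lt_le_trans (C1 i j).
have CP j : 1 <= \prod_(i < d) C i j.
  by elim/big_ind: _ => // a b a1 b1'; rewrite -[leLHS]mulr1 ler_pM.
have CP0 j : 0 < \prod_(i < d) C i j by exact: lt_le_trans (CP j).
have lnP (I : finType) (F : I -> R) : (forall i, 0 < F i) ->
    ln (\prod_i F i) = \sum_i ln (F i).
  move=> F0; suff [] : 0 < \prod_i F i /\ ln (\prod_i F i) = \sum_i ln (F i) by [].
  elim/big_rec2: _ => [|i a b _ [b0' <-]]; first by rewrite ln1.
  by rewrite mulr_gt0// lnM ?posrE.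
have H1 : 2 * kappa * \sum_(i < d) \sum_(j < m) v i j * x i j <=
    2 * kappa * tau * (\sum_(i < d) \sum_(j < m) `|v i j|)
    + (\sum_(i < d) \sum_(j < m) v i j ^+ 2) / 4
    + 16 * kappa ^+ 2 * \sum_(j in J) \sum_(i < d) ln (C i j).
  have ex (F : 'I_d -> 'I_m -> R) :
      \sum_(i < d) \sum_(j < m) F i j = \sum_(j < m) \sum_(i < d) F i j.
    exact: exchange_big.
  rewrite (ex (fun i j => v i j * x i j)) (ex (fun i j => `|v i j|)).
  rewrite (ex (fun i j => v i j ^+ 2)).
  rewrite !mulr_sumr mulr_suml [X in _ + X]big_mkcond -!big_split/=.
  apply: ler_sum => j _; case: ifPn => jJ; last first.
    rewrite big1 ?mulr0; last by move=> i _; rewrite colsupp_notin ?mul0r.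
    rewrite addr0 addr_ge0//.
      by rewrite !mulr_ge0 ?(ltW k0)// sumr_ge0.
    by rewrite divr_ge0// sumr_ge0// => i _; exact: sqr_ge0.
  rewrite !mulr_sumr mulr_suml -!big_split/=; apply: ler_sum => i _.
  by rewrite mulrA; exact: entry_bound.
have k2 : 0 <= 16 * kappa ^+ 2 by rewrite mulr_ge0// sqr_ge0.
apply: le_trans H1 _; rewrite lerD2l ler_wpM2l//.
have H2 j : \sum_(i < d) ln (C i j) <=
    - ln beta + ln (1 + beta * \prod_(i < d) C i j).
  rewrite -lnP// -lerBlDl opprK -lnM ?posrE// mulrC ler_ln ?posrE ?mulr_gt0//.
  - by rewrite lerDr.
  - by rewrite ltr_pwDl// ltW// mulr_gt0.
apply: (@le_trans _ _ (\sum_(j in J)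
    (- ln beta + ln (1 + beta * \prod_(i < d) C i j)))).
  by apply: ler_sum => j _; exact: H2.
have lnb : 0 <= - ln beta by rewrite oppr_ge0 ln_le0.
rewrite big_split/= sumr_const lerD//.
  by rewrite -[leLHS]mulr_natl ler_wpM2r// ler_nat -norm02E.
(* Each logarithm is nonnegative, so the sum extends to all columns; the bound no longer depends on
   the support. *)
apply: (@le_trans _ _ (\sum_j ln (1 + beta * \prod_(i < d) C i j))).
  rewrite [leRHS](bigID (mem J))/= lerDl sumr_ge0// => j _.
  by rewrite ln_ge0// lerDl ltW// mulr_gt0.
rewrite -lnP; last by move=> j; rewrite ltr_pwDl// ltW// mulr_gt0.
rewrite -[leRHS]expRK ler_ln ?posrE ?expR_gt0//.
by apply: prodr_gt0 => j _; rewrite ltr_pwDl// ltW// mulr_gt0.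
Qed.

End deterministic.

(** * Risk of least squares *)

Section risk.
Context (R : realType) (disp : measure_display) (T : measurableType disp)
  (P : probability T R).
Variables (n d m : nat) (sigma : R) (Z : 'I_n -> 'I_d -> 'I_m -> {RV P >-> R}).
Hypotheses (n_gt0 : (0 < n)%N) (sigma_gt0 : 0 < sigma)
  (gZ : gaussian_noise Z sigma).

Local Notation kappa := (sigma / Num.sqrt n%:R).

Let kappa_gt0 : 0 < kappa.
Proof. by rewrite divr_gt0// sqrtr_gt0 ltr0n. Qed.

Lemma mean_observationE theta w : mean_observation Z theta w =
  theta + \matrix_(i, j) (kappa * standardized_noise sigma Z (i, j) w).
Proof.
apply/matrixP => i j; rewrite /mean_observation !mxE summxE.
under eq_bigr do rewrite !mxE.
have n0 : n%:R != 0 :> R by rewrite pnatr_eq0 -lt0n.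
rewrite big_split/= sumr_const card_ord mulrDr -[theta i j *+ n]mulr_natl mulKf//.
congr (_ + _); rewrite /standardized_noise /= mulrA; congr (_ * _).
have r2 : Num.sqrt n%:R ^+ 2 = n%:R :> R by rewrite sqr_sqrtr.
rewrite -[in LHS]r2; field.
by rewrite !gt_eqF// sqrtr_gt0 ltr0n.
Qed.

(** The event bounding the potential involves the noise alone, so it serves every [theta] in the
    supremum. The factor [3 / 4] remains after the quarter of the squared error from [entry_bound]
    moves to the left, and [2 * s] counts the nonzero columns of a difference. *)
Lemma least_squares_risk (Theta : set 'M[R]_(d, m)) hat (s : nat)
    (h tau beta u e2 p : R) :
  least_squares Theta hat ->
  (forall theta, Theta theta -> (norm02 theta <= s)%N) ->
  0 <= tau -> expR (- (tau ^+ 2 / 4)) * sqexp_const R * d%:R <= h ->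
  0 < beta <= 1 -> beta * expR h * m%:R <= s%:R ->
  (forall a b, Theta a -> Theta b ->
     (\sum_(i < d) \sum_(j < m) (b - a) i j ^+ 2) * (3 / 4) <=
       2 * kappa * tau * (\sum_(i < d) \sum_(j < m) `|(b - a) i j|)
       + 16 * kappa ^+ 2 * ((2 * s)%:R * - ln beta + u) ->
     \sum_(i < d) \sum_(j < m) (b - a) i j ^+ 2 <= e2) ->
  p < 1 - expR (s%:R - u) ->
  holds_with_probability_gt P
    [set w | (sup_risk Z Theta hat w <= e2%:E)%E] p.
Proof.
move=> lsq Ts tau0 tauh beta1 betas H pu.
have sgX := subgaussian_noise sigma_gt0 n_gt0 gZ.
have beta0 : 0 <= beta by case/andP: beta1 => /ltW.
have [mA PA] := potential_tail sgX (expR_ge0 (- (tau ^+ 2 / 4))) beta0 u tauh betas.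
exists [set w | potential (standardized_noise sigma Z)
  (expR (- (tau ^+ 2 / 4))) beta w <= expR u]; split => //; last first.
  by apply: lt_le_trans PA; rewrite lte_fin.
move=> w /=; rewrite potentialE => Qw.
apply: ge_ereal_sup => _ [theta Ttheta <-].
rewrite lee_fin; have [That _] := lsq (mean_observation Z theta w).
have := least_squares_basic
  (\matrix_(i, j) (kappa * standardized_noise sigma Z (i, j) w)) lsq Ttheta.
rewrite -mean_observationE frobenius_sqr; set b := hat _ in That *.
have bs : (norm02 (b - theta) <= 2 * s)%N.
  by apply: leq_trans (norm02B _ _) _; rewrite mul2n -addnn leq_add ?Ts.
have := @sparse_noise_bound _ d m (b - theta)
  (fun i j => standardized_noise sigma Z (i, j) w) (2 * s) kappa tau beta u
  kappa_gt0 tau0 beta1 bs Qw.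
set N := 2 * \sum_i _; set N' := 2 * kappa * \sum_i _.
have -> : N = N'.
  rewrite /N /N' -mulrA; congr (_ * _); rewrite mulr_sumr.
  apply: eq_bigr => i _; rewrite mulr_sumr; apply: eq_bigr => j _.
  by rewrite !mxE -mulrA [in RHS](mulrC _ (standardized_noise _ _ _ _)).
move=> NB VN; apply: H => //; move: NB VN.
set V := \sum_i _; lra.
Qed.

End risk.

(** * Logarithmic factors and sparsity gauges *)

Section entropy.
Variable R : realType.

(** Weight [expR (- L)] on each of [b] items totals [a / e]. This calibrates [beta] with [(s, m)]
    and [alpha] with [(s0, d)]. *)
Lemma ln_ratio (a b : nat) : (1 <= a <= b)%N ->
  let L : R := ln (expR 1 * b%:R / a%:R) in
  1 <= L /\ expR (- L) * b%:R <= a%:R.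
Proof.
move=> /andP[a0 ab] L.
have a0' : 0 < a%:R :> R by rewrite ltr0n.
have b0' : 0 < b%:R :> R by rewrite ltr0n (leq_trans a0).
have r1 : expR 1 <= expR 1 * b%:R / a%:R :> R.
  by rewrite -mulrA ler_peMr ?expR_ge0// ler_pdivlMr// mul1r ler_nat.
have r0 : 0 < expR 1 * b%:R / a%:R :> R by apply: lt_le_trans r1; exact: expR_gt0.
split; first by rewrite -[leLHS]expRK ler_ln ?posrE ?expR_gt0.
rewrite expRN lnK ?posrE// invf_div.
have -> : a%:R / (expR 1 * b%:R) * b%:R = a%:R / expR 1 :> R.
  by field; rewrite !gt_eqF ?expR_gt0.
by rewrite ler_pdivrMr ?expR_gt0// ler_peMr// ?ltW// -expR0 ltr_expR.
Qed.

(** At most [2 * s] columns of the difference are nonzero, each of gauge at most [2 * B] by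
    subadditivity. *)
Lemma sum_entries_diff_le d m (F : R -> R) (B : R) (s : nat) (a b : 'M[R]_(d, m)) :
  F 0 = 0 -> (forall x y, F (x - y) <= F x + F y) ->
  (norm02 a <= s)%N -> (norm02 b <= s)%N -> 0 <= B ->
  (forall j, \sum_(i < d) F (col j a i 0) <= B) ->
  (forall j, \sum_(i < d) F (col j b i 0) <= B) ->
  \sum_(i < d) \sum_(j < m) F ((b - a) i j) <= 4 * s%:R * B.
Proof.
move=> F0 FB as_ bs B0 aB bB; rewrite exchange_big/=.
apply: (@le_trans _ _ (\sum_(j in colsupp (b - a)) (2 * B))).
  rewrite [leRHS]big_mkcond/=; apply: ler_sum => j _; case: ifPn => jJ.
    apply: (@le_trans _ _ (\sum_(i < d) (F (b i j) + F (a i j)))).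
      by apply: ler_sum => i _; rewrite !mxE.
    rewrite big_split/= mulr2n mulrDl mul1r lerD//.
      by apply: le_trans (bB j); apply: ler_sum => i _; rewrite mxE.
    by apply: le_trans (aB j); apply: ler_sum => i _; rewrite mxE.
  by rewrite big1// => i _; rewrite (colsupp_notin i jJ).
rewrite sumr_const -[leLHS]mulr_natl -norm02E.
have : (norm02 (b - a))%:R <= 2 * s%:R :> R.
  rewrite -natrM ler_nat; apply: leq_trans (norm02B _ _) _.
  by rewrite mul2n -addnn leq_add.
by move=> /(ler_wpM2r B0); lra.
Qed.

(** A ratio [z / (x + y)] in the unit interval is at most its power [q]; the ratios of [x] and [y]
    sum to 1. *)
Lemma powR_subadditive (q x y : R) : 0 < q <= 1 -> 0 <= x -> 0 <= y ->
  (x + y) `^ q <= x `^ q + y `^ q.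
Proof.
move=> /andP[q0 q1] x0 y0.
have [s0|s0] := leP (x + y) 0.
  have -> : x = 0 by lra.
  have -> : y = 0 by lra.
  by rewrite addr0 lerDl powR_ge0.
have H z : 0 <= z -> z <= x + y -> z / (x + y) * (x + y) `^ q <= z `^ q.
  move=> z0 zs; rewrite -[X in _ <= X `^ _](divfK (lt0r_neq0 s0) z).
  rewrite powRM ?divr_ge0// ?(ltW s0)// ler_wpM2r ?powR_ge0//.
  have [->|zn0] := eqVneq z 0; first by rewrite mul0r powR_ge0.
  apply: ger1_powR => //; apply/andP; split.
    by rewrite divr_gt0// lt0r zn0.
  by rewrite ler_pdivrMr// mul1r.
apply: le_trans (lerD (H x x0 _) (H y y0 _)); [|by lra|by lra].
by rewrite -mulrDl -mulrDl divff ?mul1r// gt_eqF.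
Qed.

(** If [|x|] is at least [8 * t], the quadratic term suffices. Otherwise [|x|] is split into its
    powers [q] and [1 - q], and the latter is at most 8 times the power [1 - q] of [t]. *)
Lemma powR_entry_bound (q t x : R) : 0 < q <= 1 -> 0 < t ->
  2 * t * `|x| <= x ^+ 2 / 4 + 16 * t `^ (2 - q) * `|x| `^ q.
Proof.
move=> /andP[q0 q1] t0.
rewrite -[x ^+ 2]real_normK ?num_real//.
suff H (a : R) : 0 <= a -> 2 * t * a <= a ^+ 2 / 4 + 16 * t `^ (2 - q) * a `^ q.
  exact: H.
move=> a0; have [ta|a8] := leP (8 * t) a.
  have : 0 <= a * (a - 8 * t) by rewrite mulr_ge0// subr_ge0.
  have : 0 <= 16 * t `^ (2 - q) * a `^ q by rewrite !mulr_ge0 ?powR_ge0.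
  by lra.
have [->|an0] := eqVneq a 0.
  by rewrite mulr0 addr_ge0 ?divr_ge0 ?sqr_ge0// !mulr_ge0 ?powR_ge0.
have aE : a = a `^ q * a `^ (1 - q).
  rewrite -powRD; first by rewrite addrC subrK powRr1.
  by apply/implyP.
have tE : t `^ (2 - q) = t * t `^ (1 - q).
  rewrite -{2}(powRr1 (ltW t0)) -powRD; first by congr (_ `^ _); lra.
  by apply/implyP => _; rewrite gt_eqF.
have h1 : a `^ (1 - q) <= 8 * t `^ (1 - q).
  apply: (@le_trans _ _ ((8 * t) `^ (1 - q))).
    by apply: ge0_ler_powR; rewrite ?nnegrE ?subr_ge0 ?mulr_ge0 ?(ltW t0) ?(ltW a8).
  rewrite powRM ?(ltW t0)// ler_wpM2r ?powR_ge0//.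
  by apply: ler1_powR; lra.
have h2 : 0 <= 2 * t * a `^ q by rewrite !mulr_ge0 ?powR_ge0// ltW.
have := ler_wpM2l h2 h1; have := sqr_ge0 a.
have -> : 2 * t * a = 2 * t * a `^ q * a `^ (1 - q) by rewrite -[RHS]mulrA -aE.
rewrite tE.
set A := a `^ q; set B := a `^ (1 - q); set C := t `^ (1 - q).
lra.
Qed.

End entropy.

(* [F] is the sparsity gauge of a column: the indicator of nonzero entries in
   the [l_0] case and [x |-> |x| ^ q] in the [l_q] case. *)
Lemma least_squares_gauge (R : realType) (disp : measure_display)
    (T : measurableType disp) (P : probability T R) (n d m s : nat)
    (sigma : R) (Z : 'I_n -> 'I_d -> 'I_m -> {RV P >-> R})
    (Theta : set 'M[R]_(d, m)) hat (F : R -> R) (B K L c eps : R) :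
  (0 < n)%N -> 0 < sigma -> gaussian_noise Z sigma -> (1 <= s <= m)%N ->
  least_squares Theta hat ->
  F 0 = 0 -> (forall x y, F (x - y) <= F x + F y) -> 0 <= B -> 0 <= K ->
  (forall theta, Theta theta -> (norm02 theta <= s)%N /\
     forall j, \sum_(i < d) F (col j theta i 0) <= B) ->
  0 <= L -> 0 <= c -> expR (- L) * d%:R <= c ->
  (forall x : R, 2 * (sigma / Num.sqrt n%:R * Num.sqrt (4 * L)) * `|x| <=
     x ^+ 2 / 4 + K * F x) ->
  8 * K * s%:R * B + 64 * (sigma ^+ 2 / n%:R) * s%:R *
    (ln (expR 1 * m%:R / s%:R) + sqexp_const R * c) <= eps ^+ 2 / 2 ->
  holds_with_probability_gt P
    [set w | (sup_risk Z Theta hat w <= (eps ^+ 2)%:E)%E]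
    (1 - 2 * expR (- ((128 * sigma ^+ 2)^-1 * n%:R * eps ^+ 2))).
Proof.
move=> n0 s0 gZ sm lsq F0 FB B0 K0 ThB L0 c0 Lc Fentry bound.
(* With this [u] the deviation term takes half of [eps ^+ 2] in the final bound; the hypothesis
   [bound] supplies the other half. *)
pose k2 := sigma ^+ 2 / n%:R; pose u := eps ^+ 2 / (64 * k2).
have [L1 eL1] := ln_ratio R sm.
set L' := ln _ in L1 eL1 bound.
have n0' : 0 < n%:R :> R by rewrite ltr0n.
have k20 : 0 < k2 by rewrite divr_gt0// exprn_gt0.
have g0 := sqexp_const_gt0 R.
have h0 : 0 <= sqexp_const R * c by rewrite mulr_ge0// ltW.
have t2 : Num.sqrt (4 * L) ^+ 2 = 4 * L by rewrite sqr_sqrtr// mulr_ge0.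
have kE : (sigma / Num.sqrt n%:R) ^+ 2 = k2.
  by rewrite expr_div_n sqr_sqrtr.
have s1 : 1 <= s%:R :> R by rewrite ler1n; case/andP: sm.
have uE : 64 * k2 * u = eps ^+ 2 by rewrite /u; field; rewrite !gt_eqF.
have kBs : 0 <= K * s%:R * B by rewrite !mulr_ge0.
(* Hence [s - u <= - (u / 2)], which leaves the exponent [u / 2], equal to
   [n eps ^ 2 / (128 sigma ^ 2)]. *)
have us : 2 * s%:R <= u.
  have k64 : 0 < 64 * k2 by rewrite pmulr_rgt0.
  rewrite /u ler_pdivlMr//.
  have : 0 <= k2 * s%:R * (L' + sqexp_const R * c - 1).
    apply: mulr_ge0; first by rewrite mulr_ge0// ltW.
    by rewrite subr_ge0 (le_trans L1)// lerDl.
  by move: bound; rewrite -/k2; lra.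
(* The threshold makes [alpha] equal to [expR (- L)]. In [beta], the summand [sqexp_const R * c]
   cancels [expR h], and [L'] leaves at most [s] after summing over [m] columns. *)
apply: (@least_squares_risk _ _ _ _ _ _ _ sigma _ n0 s0 gZ _ _ s (sqexp_const R * c)
  (Num.sqrt (4 * L)) (expR (- (L' + sqexp_const R * c))) u) => //.
- by move=> theta /ThB[].
- rewrite t2 (_ : 4 * L / 4 = L); last by field.
  by rewrite mulrAC mulrC ler_wpM2l// ltW.
- by rewrite expR_gt0 -[leRHS]expR0 ler_expR oppr_le0 addr_ge0// (le_trans _ L1).
- by rewrite opprD expRD -(mulrA (expR (- L'))) -expRD addNr expR0 mulr1.
- move=> a b Ta Tb; rewrite expRK opprK kE.
  have [[as_ aB] [bs bB]] := (ThB _ Ta, ThB _ Tb).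
  have FBs := sum_entries_diff_le F0 FB as_ bs B0 aB bB.
  have E : 2 * (sigma / Num.sqrt n%:R) * Num.sqrt (4 * L) *
      (\sum_(i < d) \sum_(j < m) `|(b - a) i j|) <=
      (\sum_(i < d) \sum_(j < m) (b - a) i j ^+ 2) / 4 +
      K * (\sum_(i < d) \sum_(j < m) F ((b - a) i j)).
    rewrite !mulr_sumr mulr_suml -big_split/=; apply: ler_sum => i _.
    rewrite !mulr_sumr mulr_suml -big_split/=; apply: ler_sum => j _.
    by have := Fentry ((b - a) i j); rewrite !mulrA.
  move/(ler_wpM2l K0) : FBs => FBs.
  rewrite natrM.
  move: E FBs bound uE; rewrite -/k2.
  set V : R := \sum_(i < d) \sum_(j < m) (b - a) i j ^+ 2.
  set W : R := \sum_(i < d) \sum_(j < m) `|(b - a) i j|.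
  set G : R := \sum_(i < d) \sum_(j < m) F ((b - a) i j).
  move: (Num.sqrt (4 * L)) (sigma / _) => t ka.
  lra.
- have -> : (128 * sigma ^+ 2)^-1 * n%:R * eps ^+ 2 = u / 2.
    by rewrite /u /k2; field; rewrite !gt_eqF.
  rewrite ltrD2l ltrN2.
  (* The required inequality is strict; the factor 2 in front of the exponential provides this. *)
  apply: (@le_lt_trans _ _ (expR (- (u / 2)))); last first.
    by rewrite ltr_pMl ?expR_gt0// ltr1n.
  by rewrite ler_expR; lra.
Qed.

(** * Comparison with the stated rates, and conclusion *)

(** The compensating term [g * s0] per column is absorbed by [s0 * L], as [1 <= L]. *)
Lemma rate_l0 (R : realType) (k g s s0 L L' e : R) :
  0 <= k -> 0 <= g -> 0 <= s -> 0 <= s0 -> 1 <= L -> 1 <= L' ->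
  (256 + 128 * g) * k * (s * L' + s * s0 * L) <= e ->
  8 * (16 * k * L) * s * s0 + 64 * k * s * (L' + g * s0) <= e / 2.
Proof.
move=> k0 g0 s_0 s00 L1 L1'.
have L0' : 0 <= L' by apply: le_trans L1'.
have L0 : 0 <= L - 1 by rewrite subr_ge0.
have h1 : 0 <= k * s * s0 * (L - 1) * g by rewrite !mulr_ge0.
have h2 : 0 <= k * s * L' * g by rewrite !mulr_ge0.
have h3 : 0 <= k * s * L' by rewrite !mulr_ge0.
by lra.
Qed.

(** Here the compensating term is only [g] per column, and [L'] absorbs it, as [1 <= L']. *)
Lemma rate_lq (R : realType) (k g s r A D L' e : R) :
  0 <= k -> 0 <= g -> 0 <= s -> 0 <= r -> 0 <= D -> A <= 4 * D -> 1 <= L' ->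
  1024 * (1 + g) * (k * s * L' + s * r * D) <= e ->
  8 * (16 * A) * s * r + 64 * k * s * (L' + g) <= e / 2.
Proof.
move=> k0 g0 s_0 r0 D0 AD L1'.
have L0 : 0 <= L' - 1 by rewrite subr_ge0.
have L0' : 0 <= L' by apply: le_trans L1'.
have h1 : s * r * A <= s * r * (4 * D) by rewrite ler_wpM2l// mulr_ge0.
have h2 : 0 <= k * s * (L' - 1) * g by rewrite !mulr_ge0.
have h3 : 0 <= k * s * L' by rewrite !mulr_ge0.
have h4 : 0 <= s * r * D by rewrite !mulr_ge0.
have h5 : 0 <= g * (s * r * D) by rewrite mulr_ge0.
have h6 : 0 <= g * (k * s * L') by rewrite mulr_ge0.
by lra.
Qed.

Theorem theorem2 (R : realType) (sigma : R) (sigma_gt0 : 0 < sigma) :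
  (exists Cu C1 C2 : R, [/\ 0 < Cu, 0 < C1 & 0 < C2] /\
    forall c1 c2 : R, 0 < c1 -> 0 < c2 ->
    forall n d m s s0 : nat,
      (1 <= n)%N -> (2 <= d)%N -> (1 <= s <= m)%N -> (1 <= s0 <= d)%N ->
      (4 * s <= m)%N -> c1 <= (4 * s)%:R ->
      (4 * s0 <= d)%N -> c2 <= (4 * s0)%:R ->
    forall (disp : measure_display) (T : measurableType disp)
      (P : probability T R) (Z : 'I_n -> 'I_d -> 'I_m -> {RV P >-> R}),
      gaussian_noise Z sigma ->
    forall hat : 'M[R]_(d, m) -> 'M[R]_(d, m),
      least_squares (Theta0 R d m s s0) hat ->
    forall eps : R,
      Cu * (sigma ^+ 2 / n%:R)
         * (s%:R * ln (expR 1 * m%:R / s%:R)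
            + s%:R * s0%:R * ln (expR 1 * d%:R / s0%:R)) <= eps ^+ 2 ->
      holds_with_probability_gt P
        [set w | (sup_risk Z (Theta0 R d m s s0) hat w <= (eps ^+ 2)%:E)%E]
        (1 - C1 * expR (- (C2 * n%:R * eps ^+ 2))))
  /\
  (forall q delta C3 C4 : R, 0 < q <= 1 -> 0 < delta < 1 -> 0 < C3 -> 0 < C4 ->
   exists Cu C1 C2 : R, [/\ 0 < Cu, 0 < C1 & 0 < C2] /\
    forall (n d m s : nat) (Rq : R),
      (1 <= n)%N -> (2 <= d)%N -> (1 <= s <= m)%N -> 0 < Rq ->
      C3 * d%:R `^ delta <= d%:R / (Rq * n%:R `^ (q / 2)) ->
      C4 <= C3 * d%:R `^ delta ->
    forall (disp : measure_display) (T : measurableType disp)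
      (P : probability T R) (Z : 'I_n -> 'I_d -> 'I_m -> {RV P >-> R}),
      gaussian_noise Z sigma ->
    forall hat : 'M[R]_(d, m) -> 'M[R]_(d, m),
      least_squares (Thetaq d m q s Rq) hat ->
    forall eps : R,
      Cu * (sigma ^+ 2 / n%:R * s%:R * ln (expR 1 * m%:R / s%:R)
            + s%:R * Rq * (sigma ^+ 2 / n%:R * ln d%:R) `^ (1 - q / 2))
        <= eps ^+ 2 ->
      holds_with_probability_gt P
        [set w | (sup_risk Z (Thetaq d m q s Rq) hat w <= (eps ^+ 2)%:E)%E]
        (1 - C1 * expR (- (C2 * n%:R * eps ^+ 2)))).
Proof.
have g0 := sqexp_const_gt0 R; have s2 : 0 < sigma ^+ 2 by rewrite exprn_gt0.
have rate0 : 0 < (128 * sigma ^+ 2)^-1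
  by rewrite invr_gt0; apply: mulr_gt0; [rewrite ltr0n | exact: s2].
split.
  exists (256 + 128 * sqexp_const R), 2, (128 * sigma ^+ 2)^-1; split.
    split; [|by rewrite ltr0n|exact: rate0].
    by apply: addr_gt0; [rewrite ltr0n | apply: mulr_gt0; [rewrite ltr0n | exact: g0]].
  move=> _ _ _ _ n d m s s0 n0 _ sm s0d _ _ _ _ disp T P Z gZ hat lsq eps Heps.
  have [L1 eL] := ln_ratio R s0d; have [L1' _] := ln_ratio R sm.
  have n0' : 0 < n%:R :> R by rewrite ltr0n.
  have k20 : 0 < sigma ^+ 2 / n%:R by rewrite divr_gt0.
  set L := ln (_ * d%:R / _) in L1 eL Heps.
  have L0 : 0 <= L by apply: le_trans L1.
  have kE : (sigma / Num.sqrt n%:R) ^+ 2 = sigma ^+ 2 / n%:R.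
    by rewrite expr_div_n sqr_sqrtr// ltW.
  (* [K] is [4 (kappa tau) ^ 2] with [tau ^ 2 = 4 L]: for a nonzero entry the gauge is 1 and [2
     kappa tau |x| <= x ^ 2 / 4 + 4 (kappa tau) ^ 2]. *)
  apply: (least_squares_gauge (s := s) (F := fun x : R => (x != 0)%:R)
    (B := s0%:R) (K := 16 * (sigma ^+ 2 / n%:R) * L) (L := L) (c := s0%:R)) => //.
  - by rewrite eqxx.
  - move=> x y; case: (eqVneq x 0) => [->|_]; rewrite -?natrD ler_nat.
      by rewrite sub0r oppr_eq0.
    by case: (_ != _).
  - by rewrite !mulr_ge0// ltW.
  - move=> theta [ts tb]; split => // j; rewrite -natr_sum ler_nat; exact: tb.
  - move=> x; case: (eqVneq x 0) => [->|_].
      by rewrite normr0 !mulr0 expr0n mul0r addr0.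
    rewrite mulr1; set k := sigma / _ in kE *; set t := Num.sqrt (4 * L).
    have t2 : t ^+ 2 = 4 * L by rewrite sqr_sqrtr// mulr_ge0.
    have -> : 16 * (sigma ^+ 2 / n%:R) * L = 4 * (k * t) ^+ 2.
      by rewrite exprMn kE t2; ring.
    have := sqr_ge0 (`|x| / 2 - 2 * (k * t)).
    have : `|x| ^+ 2 = x ^+ 2 by rewrite real_normK ?num_real.
    move: (k * t) `|x| => a b; lra.
  - by apply: rate_l0 Heps => //; exact: ltW.
move=> q delta C3 C4 q01 _ _ _.
exists (1024 * (1 + sqexp_const R)), 2, (128 * sigma ^+ 2)^-1; split.
  split; [|by rewrite ltr0n|exact: rate0].
  by apply: mulr_gt0; [rewrite ltr0n | apply: addr_gt0; [exact: ltr01 | exact: g0]].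
move=> n d m s Rq n0 d2 sm Rq0 _ _ disp T P Z gZ hat lsq eps Heps.
have [L1' _] := ln_ratio R sm.
have n0' : 0 < n%:R :> R by rewrite ltr0n.
have d0 : 1 < d%:R :> R by rewrite ltr1n.
have k20 : 0 < sigma ^+ 2 / n%:R by rewrite divr_gt0.
have L0 : 0 < ln d%:R :> R by rewrite ln_gt0.
pose t : R := sigma / Num.sqrt n%:R * Num.sqrt (4 * ln d%:R).
have t0 : 0 < t by rewrite mulr_gt0 ?divr_gt0// sqrtr_gt0// mulr_gt0.
have t2 : t ^+ 2 = 4 * (sigma ^+ 2 / n%:R * ln d%:R).
  rewrite exprMn expr_div_n !sqr_sqrtr ?mulr_ge0// ?(ltW L0)//; first by ring.
have [q0 q1] := andP q01.
(* The power [2 - q] of [t] is the power [1 - q / 2] of its square, and the same power of 4 is at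
   most 4. *)
have tq : t `^ (2 - q) <= 4 * (sigma ^+ 2 / n%:R * ln d%:R) `^ (1 - q / 2).
  rewrite (_ : 2 - q = 2 * (1 - q / 2)); last by field.
  rewrite powRrM (powR_mulrn 2)// ?(ltW t0)// t2 powRM//; last first.
    by rewrite mulr_ge0 ?ltW.
  by rewrite ler_wpM2r ?powR_ge0// ler1_powR//; lra.
(* [L = ln d] means [alpha = 1 / d], so a column has total weight [c = 1]. *)
apply: (least_squares_gauge (s := s) (F := fun x : R => `|x| `^ q)
  (B := Rq) (K := 16 * t `^ (2 - q)) (L := ln d%:R) (c := 1)) => //.
- by rewrite normr0 powR0// gt_eqF.
- move=> x y; apply: le_trans (powR_subadditive q01 (normr_ge0 x) (normr_ge0 y)).
  by apply: ge0_ler_powR; rewrite ?nnegrE ?addr_ge0 ?(ltW q0)// ler_normB.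
- exact: ltW.
- by rewrite mulr_ge0 ?powR_ge0.
- exact: ltW.
- by rewrite expRN lnK ?posrE ?(lt_trans ltr01)// mulVf// gt_eqF// (lt_trans ltr01).
- by move=> x; exact: powR_entry_bound.
- by rewrite mulr1; apply: rate_lq Heps => //; rewrite ?powR_ge0 ?ltW.
Qed.
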